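(* Let $G$ be a finite simple graph and let $u,v$ be two distinct vertices of $G$, each of degree at least $\widetilde{\alpha}(G)+1$, where $\widetilde{\alpha}(G)$ denotes the bipartite-hole-number of $G$. Then there exists a $(u,v)$-path in $G$ (a path with endpoints $u$ and $v$) which contains all vertices of $G$ of degree at least $\widetilde{\alpha}(G)+1$.
   Context: All graphs are finite and simple. For positive integers $s,t$, an $(s,t)$-bipartite-hole in a graph $G$ consists of two disjoint sets of vertices $S,T\subseteq V(G)$ with $|S|=s$ and $|T|=t$ such that there is no edge of $G$ with one endpoint in $S$ and the other in $T$. The bipartite-hole-number $\widetilde{\alpha}(G)$ is the minimum integer $k$ such that there exist positive integers $s$ and $t$ with $s+t=k+1$ for which $G$ does not contain an $(s,t)$-bipartite-hole. *)

(* Defs.v *)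
From mathcomp Require Import all_boot.

Set Implicit Arguments.
Unset Strict Implicit.
Unset Printing Implicit Defensive.

(* A finite simple graph is a symmetric irreflexive relation on a finType;
   the two properties are hypotheses of the theorem, and the definitions below
   make sense for any relation. *)

Section BipartiteHoles.

Variables (V : finType) (e : rel V).

Definition degree (x : V) : nat := #|[set y | e x y]|.

Definition is_bipartite_hole (s t : nat) (S T : {set V}) : bool :=
  [&& #|S| == s, #|T| == t, [disjoint S & T]
    & [forall x in S, forall y in T, ~~ e x y]].

Definition has_bipartite_hole (s t : nat) : bool :=
  [exists S : {set V}, exists T : {set V}, is_bipartite_hole s t S T].

(* Since s, t > 0 and s + t = k + 1, both s and t are < k + 2, so bounding them
   by the ordinal type loses nothing and keeps the predicate boolean. *)
Definition hole_free_split (k : nat) : bool :=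
  [exists s : 'I_k.+2, exists t : 'I_k.+2,
    [&& 0 < s, 0 < t, s + t == k + 1 & ~~ has_bipartite_hole s t]].

(* There is no (1, #|V| + 1)-bipartite-hole, for lack of vertices, so the
   minimum below is always attained. *)
Lemma hole_free_split_ex : exists k, hole_free_split k.
Proof.
exists #|V|.+1; apply/existsP; exists (inord 1).
apply/existsP; exists (inord #|V|.+1).
rewrite !inordK // add1n addn1 eqxx /=.
apply/negP => /existsP[S /existsP[T /and4P[_ /eqP cT _ _]]].
by have := max_card (mem T); rewrite cT ltnn.
Qed.

Definition bipartite_hole_number : nat := ex_minn hole_free_split_ex.

(* The path is the vertex sequence u :: p, without repetition, ending at v. *)
Definition is_path_between (u v : V) (p : seq V) : bool :=
  [&& path e u p, last u p == v & uniq (u :: p)].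

End BipartiteHoles.

(* Main.v *)
Require Import Defs.
From mathcomp Require Import all_boot.
From mathcomp Require Import zify.

(** Fix s and t with s + t = k + 1 and no (s,t)-bipartite-hole, and call large
    the vertices of degree at least s + t.  Add an apex adjacent to u and v only:
    we look for a cycle through the apex and all large vertices.  It exists once
    all pairs of large vertices have been joined by edges; the added edges are
    then removed one at a time.  If the cycle uses the removed edge xy, it opens
    into a path Q from x to y.  Taking S among the neighbours of x off Q and the
    Q-predecessors of its neighbours on Q, and T likewise from y with
    predecessors or successors, with |S|, |T| equal to s and t, the edge between
    S and T provided by the absence of a hole closes Q up again, possibly
    through new vertices.  The apex may not belong to S or T; this costs each of
    x and y at most one neighbour, which is why the degree bound is k + 1 and
    not k. *)

Set Implicit Arguments.
Unset Strict Implicit.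
Unset Printing Implicit Defensive.

(** * Counting indices along a path *)

(** Replacing neighbours on a path by their predecessors or successors shifts indices by one; false
    values at both ends ensure that nothing is lost. *)
Lemma count_iota_shift (F : nat -> bool) n :
  ~~ F 0 -> ~~ F n ->
  count (fun i => F i.+1) (iota 0 n) = count F (iota 0 n).
Proof.
move=> F0 Fn.
have E : count F (iota 0 n.+1) = F 0 + count F (iota (1 + 0) n) by [].
move: E; rewrite iotaDl count_map (negPf F0) add0n -addn1 iotaD count_cat /=.
by rewrite (negPf Fn) !addn0.
Qed.

(** The index [c] stands for the one neighbour given up to keep the apex out of a set; [F] and [G]
    are the usable neighbours on either side of a threshold. *)
Lemma leq_count_except (n c : nat) (X F G : nat -> bool) :
  (forall i, i < n -> X i -> [|| F i, G i | i == c]) ->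
  count X (iota 0 n) <= count F (iota 0 n) + count G (iota 0 n) + 1.
Proof.
move=> H.
apply: (@leq_trans (count (predU (predU F G) (pred1 c)) (iota 0 n))).
  rewrite -!size_filter; apply: uniq_leq_size; first by rewrite filter_uniq ?iota_uniq.
  move=> i; rewrite !mem_filter mem_iota /= add0n => /andP[Xi ilt].
  by rewrite ilt andbT -orbA; apply: H.
have Hc : count (pred1 c) (iota 0 n) <= 1.
  by rewrite count_uniq_mem ?iota_uniq //; case: (_ \in _).
have count_predU_le A B : count (predU A B) (iota 0 n)
    <= count A (iota 0 n) + count B (iota 0 n).
  by rewrite -count_predUI leq_addr.
by apply: leq_trans (count_predU_le _ _) _; apply: leq_add.
Qed.

(** * Sets of path vertices and ends of sequences *)

Section Crossing.

Variables (W : finType) (r : rel W).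
Hypothesis r_sym : symmetric r.
Hypothesis r_irr : irreflexive r.

Lemma card_index_set (Q : seq W) (P : pred nat) :
  uniq Q -> #|[set z in Q | P (index z Q)]| = count P (iota 0 (size Q)).
Proof.
move=> uQ; rewrite -size_filter.
have -> : [seq i <- iota 0 (size Q) | P i] =
          [seq index z Q | z <- [seq z <- Q | P (index z Q)]].
  have {1}-> : iota 0 (size Q) = [seq index z Q | z <- Q].
    case: Q uQ => // x0 Q'; move: (x0 :: Q') => {Q'}Q uQ.
    have -> : [seq index z Q | z <- Q] =
              [seq index (nth x0 Q i) Q | i <- iota 0 (size Q)].
      rewrite [RHS](map_comp (index^~ Q) (nth x0 Q)).
      by rewrite [map (nth _ _) _](mkseq_nth x0 Q).
    rewrite -[LHS]map_id; apply/eq_in_map => i; rewrite mem_iota /= add0n => il.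
    by rewrite index_uniq.
  by rewrite filter_map.
rewrite size_map -(card_uniqP _); last exact: filter_uniq.
by apply: eq_card => z; rewrite !inE mem_filter andbC.
Qed.

Lemma degree_split (x0 x : W) (Q : seq W) : uniq Q ->
  #|[set z | r x z]| =
  #|[set z | (z \notin Q) && r x z]| +
  count (fun i => r x (nth x0 Q i)) (iota 0 (size Q)).
Proof.
move=> uQ; rewrite -(card_index_set (fun i => r x (nth x0 Q i))) //.
rewrite -(cardsID [set z | z \notin Q]); congr (_ + _).
  by apply: eq_card => z; rewrite !inE andbC.
apply: eq_card => z; rewrite !inE negbK; case zQ: (z \in Q) => //=.
by rewrite nth_index.
Qed.

Lemma rev_sorted_sym (L : seq W) : sorted r (rev L) = sorted r L.
Proof. by rewrite rev_sorted; apply: eq_sorted => a b; rewrite r_sym. Qed.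

Lemma head_rev (x0 : W) (L : seq W) : head x0 (rev L) = last x0 L.
Proof. by case: (lastP L) => // L' z; rewrite rev_rcons last_rcons. Qed.

Lemma last_rev (x0 : W) (L : seq W) : last x0 (rev L) = head x0 L.
Proof. by rewrite -[L in RHS]revK head_rev. Qed.

Lemma sorted_catE (x0 : W) (A B : seq W) : 0 < size A -> 0 < size B ->
  sorted r (A ++ B) = [&& sorted r A, r (last x0 A) (head x0 B) & sorted r B].
Proof. by case: A B => [|a A] [|b B] //= _ _; rewrite cat_path. Qed.

Lemma cycle_sortedE (x0 : W) (c : seq W) : 0 < size c ->
  cycle r c = sorted r c && r (last x0 c) (head x0 c).
Proof. by case: c => //= a c _; rewrite rcons_path. Qed.

Lemma head_cat (x0 : W) (A B : seq W) :
  0 < size A -> head x0 (A ++ B) = head x0 A.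
Proof. by case: A. Qed.

Lemma last_catr (x0 : W) (A B : seq W) :
  0 < size B -> last x0 (A ++ B) = last x0 B.
Proof. by case: B => // b B; rewrite last_cat. Qed.

(** * Closing a path into a cycle *)

Definition closable (Q : seq W) :=
  exists c, [/\ cycle r c, uniq c & {subset Q <= c}].

Lemma closable_perm (Q c : seq W) :
  uniq Q -> cycle r c -> perm_eq Q c -> closable Q.
Proof.
move=> uQ cc Qc; exists c; split=> //; first by rewrite -(perm_uniq Qc).
by move=> z; rewrite (perm_mem Qc).
Qed.

Section Rotations.

Variables (x0 : W) (Q : seq W).
Hypothesis uQ : uniq Q.
Hypothesis sQ : sorted r Q.
Local Notation q := (nth x0 Q).
Local Notation y := (last x0 Q).

Lemma split2 a : 0 < a < size Q -> exists A B,
  [/\ Q = A ++ B, 0 < size A, 0 < size B &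
   [/\ head x0 A = q 0, last x0 A = q a.-1, head x0 B = q a & last x0 B = y]].
Proof.
move=> /andP[a0 an]; exists (take a Q), (drop a Q).
have sA : size (take a Q) = a by rewrite size_take an.
have sB : 0 < size (drop a Q) by rewrite size_drop subn_gt0.
split; rewrite ?cat_take_drop ?sA //; split.
- by rewrite -nth0 nth_take.
- by rewrite -nth_last sA nth_take // prednK.
- by rewrite -nth0 nth_drop addn0.
- by rewrite -{2}(cat_take_drop a Q) last_catr.
Qed.

Lemma split3 a b : 0 < a < b -> b < size Q -> exists A B C,
  [/\ Q = A ++ B ++ C, [/\ 0 < size A, 0 < size B & 0 < size C],
   [/\ head x0 A = q 0, last x0 A = q a.-1 & head x0 B = q a] &
   [/\ last x0 B = q b.-1, head x0 C = q b & last x0 C = y]].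
Proof.
move=> /andP[a0 ab] bn; exists (take a Q), (take (b - a) (drop a Q)), (drop b Q).
have an := ltn_trans ab bn.
have sA : size (take a Q) = a by rewrite size_take an.
have sB : size (take (b - a) (drop a Q)) = b - a.
  by rewrite size_take size_drop ltn_sub2r.
have sC : 0 < size (drop b Q) by rewrite size_drop subn_gt0.
split; rewrite ?sA ?sB ?subn_gt0 //.
- have -> : drop b Q = drop (b - a) (drop a Q) by rewrite drop_drop subnK // ltnW.
  by rewrite !cat_take_drop.
- split; first by rewrite -nth0 nth_take.
    by rewrite -nth_last sA nth_take // prednK.
  by rewrite -nth0 nth_take ?subn_gt0 // nth_drop addn0.
split.
- rewrite -nth_last sB nth_take; last by lia.
  by rewrite nth_drop; congr (nth _ _ _); lia.
- by rewrite -nth0 nth_drop addn0.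
- by rewrite -{2}(cat_take_drop b Q) last_catr.
Qed.

(* The cycle is q(a-1) .. q 0, q a .. q(b-1), y .. q b. *)
Lemma rotate_out a b : 0 < a < b -> b < size Q ->
  r (q 0) (q a) -> r y (q b.-1) -> r (q a.-1) (q b) -> closable Q.
Proof.
move=> ab bn; have [A [B [C [EQ [sA sB sC] [<- <- <-] [<- <- <-]]]]] := split3 ab bn.
move=> r1 r2 r3; move: sQ; rewrite EQ.
have sBC : 0 < size (B ++ C) by rewrite size_cat; lia.
rewrite (sorted_catE x0) // (sorted_catE x0) // => /and3P[s1 _ /and3P[s2 _ s3]].
apply: (@closable_perm _ (rev A ++ B ++ rev C)); rewrite -?EQ //.
  have sBrC : 0 < size (B ++ rev C) by rewrite size_cat; lia.
  rewrite (cycle_sortedE x0) ?size_cat ?size_rev ?addn_gt0 ?sA //.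
  rewrite !(sorted_catE x0) ?size_rev // !last_catr ?head_cat ?size_rev //.
  rewrite !head_rev !last_rev !rev_sorted_sym s1 s2 s3 /= r1.
  by rewrite [r (last _ B) _]r_sym r2 r_sym r3.
rewrite EQ perm_sym; apply: perm_cat; first by rewrite perm_rev.
by rewrite perm_cat2l perm_rev.
Qed.

(* The cycle is q(b-1) .. q a, y .. q b, q 0 .. q(a-1). *)
Lemma rotate_in a b : 0 < a < b -> b < size Q ->
  r (q 0) (q b) -> r y (q a) -> r (q a.-1) (q b.-1) -> closable Q.
Proof.
move=> ab bn; have [A [B [C [EQ [sA sB sC] [<- <- <-] [<- <- <-]]]]] := split3 ab bn.
move=> r1 r2 r3; move: sQ; rewrite EQ.
have sBC : 0 < size (B ++ C) by rewrite size_cat; lia.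
rewrite (sorted_catE x0) // (sorted_catE x0) // => /and3P[s1 _ /and3P[s2 _ s3]].
apply: (@closable_perm _ (rev B ++ rev C ++ A)); rewrite -?EQ //.
  have sCA : 0 < size (rev C ++ A) by rewrite size_cat; lia.
  rewrite (cycle_sortedE x0) ?size_cat ?size_rev ?addn_gt0 ?sB //.
  rewrite !(sorted_catE x0) ?size_rev // !last_catr ?head_cat ?size_rev //.
  rewrite !head_rev !last_rev !rev_sorted_sym s1 s2 s3 /=.
  by rewrite [r (head _ B) _]r_sym r2 [r (head _ C) _]r_sym r1 r3.
rewrite EQ perm_sym catA perm_catC perm_cat2l.
by apply: perm_cat; rewrite perm_rev.
Qed.

(** The cycle is w, q 0 .. q(a-1), y .. q a. *)
Lemma detour_left w a : 0 < a < size Q -> w \notin Q ->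
  r w (q 0) -> r y (q a.-1) -> r w (q a) -> closable Q.
Proof.
move=> an wQ; have [A [B [EQ sA sB [<- <- <- <-]]]] := split2 an.
move=> r1 r2 r3; move: sQ; rewrite EQ (sorted_catE x0) // => /and3P[s1 _ s2].
exists (w :: A ++ rev B); split.
- rewrite (cycle_sortedE x0) // -cat1s (sorted_catE x0) ?size_cat ?addn_gt0 ?sA //.
  rewrite (sorted_catE x0) ?size_rev // last_catr ?size_cat ?addn_gt0 ?sA //.
  rewrite last_catr ?size_rev // head_cat //= head_rev last_rev rev_sorted_sym.
  by rewrite s1 s2 r1 r_sym r2 r_sym r3.
- have pQ : perm_eq (A ++ rev B) Q by rewrite EQ perm_cat2l perm_rev.
  by rewrite /= (perm_uniq pQ) uQ (perm_mem pQ) wQ.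
- by move=> z; rewrite inE !mem_cat mem_rev => ->; rewrite orbT.
Qed.

(** The cycle is w, q(a-1) .. q 0, q a .. y. *)
Lemma detour_right w a : 0 < a < size Q -> w \notin Q ->
  r w y -> r (q 0) (q a) -> r (q a.-1) w -> closable Q.
Proof.
move=> an wQ; have [A [B [EQ sA sB [<- <- <- <-]]]] := split2 an.
move=> r1 r2 r3; move: sQ; rewrite EQ (sorted_catE x0) // => /and3P[s1 _ s2].
exists (w :: rev A ++ B); split.
- rewrite (cycle_sortedE x0) // -cat1s (sorted_catE x0) ?size_cat ?size_rev ?addn_gt0 ?sA //.
  rewrite (sorted_catE x0) ?size_rev // last_catr ?size_cat ?size_rev ?addn_gt0 ?sA //.
  rewrite last_catr // head_cat ?size_rev //= head_rev last_rev rev_sorted_sym.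
  by rewrite s1 s2 r2 [r w _]r_sym r3 r_sym r1.
- have pQ : perm_eq (rev A ++ B) Q by rewrite EQ perm_cat2r perm_rev.
  by rewrite /= (perm_uniq pQ) uQ (perm_mem pQ) wQ.
- by move=> z; rewrite inE !mem_cat mem_rev => ->; rewrite orbT.
Qed.

Lemma detour_one w : 0 < size Q -> w \notin Q ->
  r (q 0) w -> r y w -> closable Q.
Proof.
rewrite nth0 => Q0 wQ r1 r2; exists (w :: Q); split.
- rewrite (cycle_sortedE x0) // -cat1s (sorted_catE x0) // sQ last_catr //=.
  by rewrite r_sym r1 r2.
- by rewrite /= wQ.
- by move=> z; rewrite inE orbC => ->.
Qed.

(** The cycle is w', w, q 0 .. y. *)
Lemma detour_two w w' : 0 < size Q -> w \notin Q -> w' \notin Q -> w != w' ->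
  r (q 0) w -> r y w' -> r w w' -> closable Q.
Proof.
rewrite nth0 => Q0 wQ w'Q ww' r1 r2 r3; exists (w' :: w :: Q); split.
- rewrite (cycle_sortedE x0) // -(cat1s w') -(cat1s w) !(sorted_catE x0) // sQ !last_catr //=.
  by rewrite [r w' w]r_sym r3 [r w _]r_sym r1 r2.
- by rewrite /= inE negb_or eq_sym ww' w'Q wQ.
- by move=> z zQ; rewrite !inE zQ !orbT.
Qed.

End Rotations.

Lemma card_off_on (Q : seq W) (A : pred W) (P : pred nat) : uniq Q ->
  #|[set z | (z \notin Q) && A z] :|: [set z in Q | P (index z Q)]| =
  #|[set z | (z \notin Q) && A z]| + count P (iota 0 (size Q)).
Proof.
move=> uQ; rewrite -(card_index_set P) // cardsU.
suff -> : [set z | (z \notin Q) && A z] :&: [set z in Q | P (index z Q)] = set0.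
  by rewrite cards0 subn0.
by apply/setP=> z; rewrite !inE; case: (z \in Q); rewrite ?andbF.
Qed.

(** Here [d] is the apex. The absence of a hole in the original graph yields edges only between sets
    of original vertices, so [S] and [T] must avoid [d]. *)
Lemma close_path (d x0 : W) (s t : nat) (Q : seq W) :
  0 < s -> 0 < t ->
  (forall S T : {set W}, d \notin S -> d \notin T -> [disjoint S & T] ->
     s <= #|S| -> t <= #|T| -> exists a b, [/\ a \in S, b \in T & r a b]) ->
  uniq Q -> sorted r Q -> d \in Q ->
  s + t <= #|[set z | r (nth x0 Q 0) z]| ->
  s + t <= #|[set z | r (last x0 Q) z]| ->
  closable Q.
Proof.
move=> s0 t0 hole uQ sQ dQ; set q := nth x0 Q; set y := last x0 Q.
have n0 : 0 < size Q by case: Q dQ {uQ sQ q y}.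
case: (boolP (r y (q 0))) => [yx _ _|/negPf yx].
  apply: (@closable_perm Q Q) => //.
  by rewrite (cycle_sortedE x0) // sQ -nth0.
rewrite (degree_split x0 (q 0) uQ) (degree_split x0 y uQ).
set n := size Q in n0 *; set k := index d Q.
have qk z : z \in Q -> q (index z Q) = z by move=> zQ; rewrite /q nth_index.
have qn : q n.-1 = y by rewrite /q /n nth_last.
set X := fun i => r (q 0) (q i); set Y := fun i => r y (q i).
set A := [set z | (z \notin Q) && r (q 0) z].
set B := [set z | (z \notin Q) && r y z] => dx dy.
have X0 : X 0 = false by rewrite /X r_irr.
have Y0 : Y 0 = false by [].
have Yn : Y n.-1 = false by rewrite /Y qn r_irr.
(* The neighbour of index k + 1 is discarded because its predecessor is [d]. *)
pose X' i := X i && (i != k.+1).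
pose FX m := count (fun i => X' i && (i <= m)) (iota 0 n).
(* At least s + t - 1 neighbours of x remain, and t > 0. *)
have FXn : s <= #|A| + FX n.
  have := @leq_count_except n k.+1 X (fun i => X' i && (i <= n)) pred0.
  rewrite -/(FX n) count_pred0 addn0 => H.
  suff /H : forall i, i < n -> X i -> [|| X' i && (i <= n), pred0 i | i == k.+1].
    by move: dx t0; rewrite -/X; clear; lia.
  by move=> i /ltnW -> Xi; rewrite /X' Xi /=; case: eqP.
have ex_m : exists m, s <= #|A| + FX m by exists n.
(* If m > 0 then, by minimality, x also keeps t usable neighbours of index at
   least m.  So either y has t usable neighbours off Q or of index at least m, or
   it has s of index below m; in the latter case the off-Q vertices are not used. *)
have [m sm min_m] := ex_minnP ex_m.
(* These neighbours of y are replaced by their successors, so i + 1 = k would select [d]. *)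
pose GY i := [&& Y i, m <= i, i.+1 < n & i.+1 != k].
have [tG|Gt] := leqP t (#|B| + count GY (iota 0 n)).
  (* Predecessors for x up to the threshold [m], successors for y from [m] on: the order of indices
     needed by [rotate_out]. *)
  pose PS i := [&& i.+1 < n, X' i.+1 & i.+1 <= m].
  pose PT j := [&& 0 < j, Y j.-1, m <= j.-1 & j != k].
  have cS : count PS (iota 0 n) = FX m.
    pose F i := [&& i < n, X' i & i <= m].
    rewrite (@eq_count _ PS (fun i => F i.+1)) // count_iota_shift.
    - by apply: eq_in_count => i; rewrite mem_iota add0n /F /= => ->.
    - by rewrite /F /X' X0 andbF.
    - by rewrite /F ltnn.
  have cT : count PT (iota 0 n) = count GY (iota 0 n).
    pose F i := (i < n) && PT i.
    rewrite (@eq_in_count _ PT F); last by move=> i; rewrite mem_iota add0n /F /= => ->.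
    rewrite -(@count_iota_shift F).
    - by apply: eq_count => i; rewrite /F /PT /GY /=; case: (_ < n); rewrite /= ?andbF.
    - by rewrite /F /PT andbF.
    - by rewrite /F ltnn.
  set S := A :|: [set z in Q | PS (index z Q)].
  set T := B :|: [set z in Q | PT (index z Q)].
  have dS : d \notin S by rewrite !inE dQ /= -/k /PS /X' eqxx !andbF.
  have dT : d \notin T by rewrite !inE dQ /= -/k /PT eqxx !andbF.
  have sS : s <= #|S| by rewrite card_off_on // -/n cS.
  have tT : t <= #|T| by rewrite card_off_on // -/n cT.
  (* On Q a common vertex would have index both below and above [m]; off Q it is a common neighbour
     of x and y and closes the path by itself. *)
  have [dST|] := boolP [disjoint S & T]; last first.
    rewrite -setI_eq0 => /set0Pn[w]; rewrite !inE.
    case wQ: (w \in Q) => /=; last first.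
      rewrite !orbF => /andP[w1 w2].
      by apply: (@detour_one x0 Q uQ sQ w); rewrite ?wQ.
    by move=> /andP[/and3P[_ _ h1] /and4P[_ _ h2 _]]; move: h1 h2; clear; lia.
  have [a [b [aS bT ab]]] := hole S T dS dT dST sS tT.
  move: aS bT; rewrite !inE.
  (* Each end of the edge is on or off Q: the four cases are a rotation, the two one-vertex detours
     and the two-vertex detour. *)
  case aQ: (a \in Q); case bQ: (b \in Q) => /=; rewrite ?orbF.
  - move=> /and3P[h1 /andP[h2 _] h3] /and4P[h4 h5 h6 _].
    have bn : index b Q < n by rewrite index_mem.
    apply: (@rotate_out x0 Q uQ sQ (index a Q).+1 (index b Q)) => //.
    + by move: h3 h4 h6; clear; lia.
    + by rewrite -/q /= !qk.
  - move=> /and3P[h1 /andP[h2 _] h3] yb.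
    apply: (@detour_right x0 Q uQ sQ b (index a Q).+1) => //; rewrite ?bQ //.
      by rewrite r_sym.
    by rewrite -/q /= qk.
  - move=> xa /and4P[h4 h5 h6 _].
    apply: (@detour_left x0 Q uQ sQ a (index b Q)) => //; rewrite ?aQ //.
    + by rewrite h4 index_mem.
    + by rewrite r_sym.
    + by rewrite -/q qk.
  - move=> xa yb; apply: (@detour_two x0 Q uQ sQ a b) => //; rewrite ?aQ ?bQ //.
    by apply: contraTneq ab => ->; rewrite r_irr.
have Yi i : i < n -> Y i -> i.+1 < n.
  move=> ilt Yi; have : i != n.-1 by apply: contraTneq Yi => ->; rewrite Yn.
  by move: ilt; clear; lia.
(* If m = 0, then [GY] misses at most the neighbour of index k - 1, so y would have at least s + t -
   1 >= t usable neighbours. *)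
have m0 : 0 < m.
  rewrite lt0n; apply/eqP => m_0.
  have := @leq_count_except n k.-1 Y GY pred0; rewrite count_pred0 addn0 => H.
  suff /H : forall i, i < n -> Y i -> [|| GY i, pred0 i | i == k.-1].
    by move: dy Gt t0 s0; rewrite -/Y; clear; lia.
  move=> i ilt Yy; rewrite /GY Yy (Yi i) // m_0 /=.
  by case: (eqVneq i.+1 k) => [<-|//]; rewrite eqxx.
(* Now both sets consist of predecessors, with x taking the neighbours from [m] on and y those below
   [m], as [rotate_in] requires. *)
pose PS i := [&& i.+1 < n, X' i.+1 & m <= i.+1].
pose PT j := [&& j.+1 < n, Y j.+1, j.+1 < m & j.+1 != k.+1].
have cS : t <= count PS (iota 0 n).
  pose F i := [&& i < n, X' i & m <= i].
  rewrite (@eq_count _ PS (fun i => F i.+1)) // count_iota_shift.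
  (* By minimality of [m], at most s - 1 neighbours count off Q or up to m - 1; one more may be
     discarded, and at least t remain. *)
  - have := @leq_count_except n k.+1 X (fun i => X' i && (i <= m.-1)) F => H.
    suff /H : forall i, i < n -> X i -> [|| X' i && (i <= m.-1), F i | i == k.+1].
      have : ~~ (s <= #|A| + FX m.-1).
        by apply/negP => /min_m; move: m0; clear; lia.
      by move: dx; rewrite -/X /FX; clear; lia.
    move=> i ilt Xi; rewrite /F /X' Xi ilt /=.
    by case: (eqVneq i k.+1) => _; rewrite ?orbT //=; clear; lia.
  - by rewrite /F /X' X0 andbF.
  - by rewrite /F ltnn.
have cT : s <= count PT (iota 0 n).
  pose F i := [&& i < n, Y i, i < m & i != k.+1].
  rewrite (@eq_count _ PT (fun i => F i.+1)) // count_iota_shift.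
  (* From [m] on the index lost is k - 1, below [m] it is k + 1. Since k - 1 >= m and k + 1 < m
     exclude each other, only one neighbour is lost in total. *)
  - have := @leq_count_except n (if m <= k.-1 then k.-1 else k.+1) Y GY F => H.
    suff /H : forall i, i < n -> Y i ->
        [|| GY i, F i | i == if m <= k.-1 then k.-1 else k.+1].
      by move: dy Gt t0 s0; rewrite -/Y; clear; lia.
    move=> i ilt Yy; rewrite /F /GY Yy ilt (Yi i) //=.
    by case: (leqP m k.-1); case: (leqP m i) => /=; move: m0; clear; lia.
  - by rewrite /F Y0 andbF.
  - by rewrite /F ltnn.
set S := [set z in Q | PS (index z Q)]; set T := [set z in Q | PT (index z Q)].
have dS : d \notin S by rewrite !inE dQ /= -/k /PS /X' eqxx !andbF.
have dT : d \notin T by rewrite !inE dQ /= -/k /PT eqxx !andbF.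
have dTS : [disjoint T & S].
  rewrite -setI_eq0; apply/eqP/setP => w; rewrite !inE; apply/negP.
  by case/andP=> /andP[_ /and4P[_ _ h1 _]] /andP[_ /and3P[_ _ h2]];
    move: h1 h2; clear; lia.
(* The sizes are exchanged: [T] has at least s vertices and [S] at least t. *)
have [|| b [a [bT aS ba]]] := hole T S dT dS dTS; rewrite ?card_index_set //.
move: aS bT; rewrite !inE => /andP[aQ /and3P[h1 /andP[h2 _] h3]].
move=> /andP[bQ /and4P[h4 h5 h6 _]].
apply: (@rotate_in x0 Q uQ sQ (index b Q).+1 (index a Q).+1) => //.
  by move: h3 h6; clear; lia.
by rewrite -/q /= !qk.
Qed.

End Crossing.

(** * Adding and removing edges between large vertices *)

Section Closure.

Variable W : finType.

Definition add_edge (x y : W) (r : rel W) : rel W :=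
  fun a b => [|| r a b, (a == x) && (b == y) | (a == y) && (b == x)].

(** Some step of the cycle, from a to b, is not in [r], so it is the added edge. Rotating the cycle
    to start at b and end at a leaves out that step, and no other step can join the same two
    vertices once there are at least three. *)
Lemma open_cycle (r : rel W) (x y : W) (c : seq W) :
  x != y -> cycle (add_edge x y r) c -> uniq c -> 2 < size c -> ~~ cycle r c ->
  exists Q, [/\ perm_eq Q c, sorted r Q &
    (head x Q = x /\ last x Q = y) \/ (head x Q = y /\ last x Q = x)].
Proof.
move=> xy cc uc c2 ncc.
have /allPn[a ac nra] : ~~ all (fun a => r a (next c a)) c.
  by apply: contra ncc => /allP H; apply: cycle_from_next.
set b := next c a in nra; have bc : b \in c by rewrite mem_next.
have ab_xy : (a == x) && (b == y) || (a == y) && (b == x).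
  by move: (next_cycle cc ac); rewrite /add_edge -/b (negPf nra).
have [i p Ep] := rot_to bc.
have uQ : uniq (b :: p) by rewrite -Ep rot_uniq.
have lp : last b p = a.
  have <- : prev (b :: p) b = a by rewrite -Ep prev_rot // /b prev_next.
  have /memNindex Ib : b \notin p by case/andP: uQ.
  by rewrite prev_nth mem_head Ib (last_nth b).
exists (b :: p); split.
- by rewrite -Ep perm_rot.
- have sp : 1 < size p by move: c2; rewrite -(size_rot i) Ep.
  have cQ : path (add_edge x y r) b p.
    by move: cc; rewrite -(rot_cycle i) Ep /= rcons_path => /andP[].
  move: uQ cQ sp lp; case: (lastP p) => // q z uQ cQ sp.
  rewrite last_rcons => za; rewrite za in uQ cQ sp *.
  have na w : w \in b :: q -> w != a.
    move=> wq; apply: contraTneq uQ => <-.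
    by rewrite -rcons_cons rcons_uniq wq.
  move: cQ; rewrite /= !rcons_path => /andP[p1 p2]; apply/andP; split.
    apply: sub_in_path p1; last first.
      by apply/allP => w; exact: na.
    move=> w w' /= wa w'a; rewrite /add_edge.
    by case/orP: ab_xy => /andP[/eqP <- /eqP <-];
      rewrite (negPf wa) (negPf w'a) ?andbF ?orbF.
  (* The final step into a could be the added edge again only if it came from b, which would make
     the cycle have two vertices. *)
  have nb : last b q != b.
    move: uQ sp; rewrite -rcons_cons rcons_uniq => /andP[_].
    case/lastP: q {p1 p2 na} => // q w /andP[bq _] _.
    by rewrite last_rcons; apply: contraNneq bq => ->; rewrite mem_rcons mem_head.
  have nl := na _ (mem_last b q); move: p2; rewrite /add_edge.
  by case/orP: ab_xy => /andP[/eqP <- /eqP <-];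
      rewrite (negPf nb) (negPf nl) ?andbF ?orbF.
- case/orP: ab_xy => /andP[/eqP ax /eqP bY].
    by right; rewrite /= lp.
  by left; rewrite /= lp.
Qed.

(** Induction on the number of nonadjacent ordered pairs, in the manner of the Bondy-Chvatal closure
    restricted to [L]. All hypotheses survive the addition of an edge inside [L], and [close_path]
    brings the cycle back to [r]. *)
Lemma cycle_through_large (d u v : W) (L : {set W}) (s t : nat) :
  0 < s -> 0 < t -> u \in L -> v \in L -> u != v -> d \notin L ->
  forall r : rel W, symmetric r -> irreflexive r ->
  (forall S T : {set W}, d \notin S -> d \notin T -> [disjoint S & T] ->
     s <= #|S| -> t <= #|T| -> exists a b, [/\ a \in S, b \in T & r a b]) ->
  (forall x, x \in L -> s + t <= #|[set z | r x z]|) ->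
  r d u -> r d v -> exists c, [/\ cycle r c, uniq c & {subset d |: L <= c}].
Proof.
move=> s0 t0 uL vL uv dL r.
have [m] := ubnP #|[set p : W * W | ~~ r p.1 p.2]|.
elim: m r => // m IH r lem r_sym r_irr hole deg du dv.
have [/existsP[x /existsP[y /and4P[xL yL xy nxy]]]|complete] :=
    boolP [exists x, exists y, [&& x \in L, y \in L, x != y & ~~ r x y]].
  set r' := add_edge x y r.
  have sub_r a b : r a b -> r' a b by rewrite /r' /add_edge => ->.
  have [c [cc uc Lc]] :
      exists c, [/\ cycle r' c, uniq c & {subset d |: L <= c}].
    apply: IH.
    - apply: leq_trans (_ : _ < #|[set p : W * W | ~~ r p.1 p.2]|) _ => //.
      apply: proper_card; apply/properP; split.
        by apply/subsetP => p; rewrite !inE; apply: contra; apply: sub_r.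
      by exists (x, y); rewrite !inE /= ?nxy // /r' /add_edge !eqxx orbT.
    - move=> a b; rewrite /r' /add_edge r_sym; congr (_ || _).
      by rewrite orbC; congr (_ || _); rewrite andbC.
    - move=> a; rewrite /r' /add_edge r_irr /=.
      by apply: contraNF xy => /orP[] /andP[/eqP <- /eqP <-].
    - move=> S T dS dT ST sS tT; have [a [b [aS bT ab]]] := hole S T dS dT ST sS tT.
      by exists a, b; split=> //; apply: sub_r.
    - move=> z zL; apply: leq_trans (deg z zL) _; apply: subset_leq_card.
      by apply/subsetP => w; rewrite !inE; apply: sub_r.
    - exact: sub_r.
    - exact: sub_r.
  have [cr|ncr] := boolP (cycle r c); first by exists c.
  have c2 : 2 < size c.
    have -> : 2 = size [:: u; v] by [].
    rewrite -[X in X < _]/(size [:: d; u; v]).-1 prednK //.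
    apply: uniq_leq_size.
      rewrite /= !inE uv andbT negb_or.
      by apply/andP; split; [apply/andP; split|]; rewrite // (contraNneq _ dL) // => ->.
    move=> z; rewrite !inE => /or3P[] /eqP ->; apply: Lc;
      by rewrite !inE ?eqxx ?uL ?vL ?orbT.
  have [Q [Qc sQ ends]] := open_cycle xy cc uc c2 ncr.
  have uQ : uniq Q by rewrite (perm_uniq Qc).
  have dQ : d \in Q by rewrite (perm_mem Qc) Lc // setU11.
  have [c' [cc' uc' Qc']] : closable r Q.
    apply: (@close_path _ r r_sym r_irr d x s t) => //; rewrite ?nth0;
      by case: ends => -[hx lx]; rewrite ?hx ?lx; apply: deg.
  exists c'; split=> // z zL; apply: Qc'; rewrite (perm_mem Qc); exact: Lc.
(* Now [L] is a clique: its other vertices can be listed between u and v in any order, and [d]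
   closes the cycle. *)
pose c := [seq z <- enum L | z != u & z != v].
exists (d :: u :: rcons c v).
have uc : uniq (u :: rcons c v).
  rewrite /= mem_rcons inE negb_or uv rcons_uniq filter_uniq ?enum_uniq //.
  by rewrite !mem_filter !eqxx /= andbF.
have mem_c z : (z \in u :: rcons c v) = (z \in L).
  rewrite inE mem_rcons inE mem_filter mem_enum.
  case: eqVneq => [->|_] /=; first by rewrite uL.
  by case: eqVneq => [->|_] /=; rewrite ?vL.
have sc : path r u (rcons c v).
  change (sorted r (u :: rcons c v)); apply: pairwise_sorted.
  have : pairwise [rel a b | a != b] (u :: rcons c v) by rewrite -uniq_pairwise.
  apply: (@sub_in_pairwise _ [in L]); last by apply/allP => z; rewrite mem_c.
  move=> a b aL bL /= ab; apply: contraNT complete => nab.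
  by apply/existsP; exists a; apply/existsP; exists b; apply/and4P.
split.
- rewrite (cycle_path d) /= last_rcons r_sym dv du /=.
  exact: sc.
- by rewrite cons_uniq uc mem_c dL.
- by move=> z; rewrite in_setU1 [in X in _ -> X]inE mem_c.
Qed.

End Closure.

(** * From bipartite holes to the apex graph *)

(** A hole has exact sizes, so both sets are first shrunk to s and t vertices. *)
Lemma large_sets_have_edge (V : finType) (e : rel V) (s t : nat) (S T : {set V}) :
  ~~ has_bipartite_hole e s t -> [disjoint S & T] -> s <= #|S| -> t <= #|T| ->
  exists a b, [/\ a \in S, b \in T & e a b].
Proof.
move=> nohole dST sS tT.
have subset_of_card (A : {set V}) k :
    k <= #|A| -> exists2 B : {set V}, B \subset A & #|B| = k.
  move=> kA; exists [set z in take k (enum A)].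
    by apply/subsetP => z; rewrite inE => /mem_take; rewrite mem_enum.
  rewrite cardsE (card_uniqP _) ?take_uniq ?enum_uniq //.
  by rewrite size_takel // -cardE.
have [S' S'S cS] := subset_of_card _ _ sS.
have [T' T'T cT] := subset_of_card _ _ tT.
have [/existsP[a /existsP[b /and3P[aS bT ab]]]|none] :=
    boolP [exists a, exists b, [&& a \in S', b \in T' & e a b]].
  by exists a, b; split; rewrite ?(subsetP S'S) ?(subsetP T'T).
case/negP: nohole; apply/existsP; exists S'; apply/existsP; exists T'.
rewrite /is_bipartite_hole cS cT !eqxx /=; apply/andP; split.
  by apply: disjointWl S'S _; apply: disjointWr T'T _.
apply/forall_inP => a aS; apply/forall_inP => b bT; apply: contra none => ab.
by apply/existsP; exists a; apply/existsP; exists b; apply/and3P.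
Qed.

(** [None] is the apex; using [option V] makes it a new vertex. *)
Definition apex_rel (V : finType) (e : rel V) (u v : V) : rel (option V) :=
  fun a b => match a, b with
  | Some a, Some b => e a b
  | None, Some z | Some z, None => (z == u) || (z == v)
  | None, None => false
  end.

(** Removing [None] from the cycle leaves a path whose ends are neighbours of [None], hence u and v
    in one order or the other. *)
Lemma apex_cycle_path (V : finType) (e : rel V) (u v : V) (c : seq (option V)) :
  symmetric e -> u != v -> cycle (apex_rel e u v) c -> uniq c ->
  None \in c -> Some u \in c -> Some v \in c ->
  exists p, is_path_between e u v p /\ (forall x, Some x \in c -> x \in u :: p).
Proof.
move=> e_sym uv cc uc Nc uc' vc'; have [i q Eq] := rot_to Nc.
have uq : uniq (None :: q) by rewrite -Eq rot_uniq.
have mc z : (z \in c) = (z \in None :: q) by rewrite -Eq mem_rot.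
have cq : cycle (apex_rel e u v) (None :: q) by rewrite -Eq rot_cycle.
rewrite !mc !inE /= in uc' vc'.
have [p Ep] : exists p, q = map Some p.
  move: uq; rewrite /= => /andP[Nq _]; exists (pmap id q).
  elim: q Nq {Eq mc cq uc' vc'} => //= -[a|] q IH; rewrite inE //= => Nq.
  by rewrite -IH.
have memS x : (Some x \in q) = (x \in p) by rewrite Ep mem_map // => a b [].
have {}mc x : Some x \in c -> x \in p by rewrite mc inE /= memS.
rewrite memS in uc'; rewrite memS in vc'.
have up : uniq p by move: uq; rewrite /= Ep map_inj_uniq => [/andP[]|a b []].
case: p => [//|a p] in Ep memS mc uc' vc' up *.
move: cq; rewrite Ep /= rcons_path last_map.
case/andP=> auv /andP[pp luv].
have {}pp : path e a p.
  by move: pp; rewrite path_map.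
(* Both u and v lie on the path, so it has at least two vertices and its ends differ. *)
have al : a != last a p.
  case: (lastP p) => [|p' z] in uc' vc' up *.
    by move: uc' vc' uv; rewrite !inE => /eqP -> /eqP ->; rewrite eqxx.
  rewrite last_rcons; apply: contraTneq up => ->.
  by rewrite /= mem_rcons mem_head.
case/orP: auv => /eqP Ea; case/orP: luv => /eqP El.
- by rewrite El Ea eqxx in al.
- by exists p; rewrite -Ea; split=> //; rewrite /is_path_between pp El eqxx.
(* The path runs from v to u and is reversed. *)
- have Er : rev (a :: p) = u :: behead (rev (a :: p)).
    have := head_rev a (a :: p); rewrite [last _ _]El.
    by case: (rev (a :: p)) (size_rev (a :: p)) => //= b q' _ ->.
  exists (behead (rev (a :: p))); split; last first.
    by move=> x /mc xp; rewrite -Er mem_rev.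
  rewrite /is_path_between -Er rev_uniq up andbT.
  have -> : path e u (behead (rev (a :: p))) = sorted e (rev (a :: p)) by rewrite {2}Er.
  rewrite rev_sorted_sym // /= pp /=.
  by rewrite -[last _ _]/(last u (u :: _)) -Er last_rev /= Ea.
- by rewrite El Ea eqxx in al.
Qed.

Theorem theorem1p8 (V : finType) (e : rel V)
    (e_sym : symmetric e) (e_irr : irreflexive e)
    (u v : V) (u_neq_v : u <> v)
    (deg_u : bipartite_hole_number e + 1 <= degree e u)
    (deg_v : bipartite_hole_number e + 1 <= degree e v) :
  exists p : seq V,
    is_path_between e u v p /\
    (forall x : V, bipartite_hole_number e + 1 <= degree e x -> x \in u :: p).
Proof.
have uv : u != v by apply/eqP.
move: deg_u deg_v; rewrite /bipartite_hole_number.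
(* With k + 1 rewritten as s + t, the degree bounds take the form used by [cycle_through_large]. *)
case: ex_minnP => k /existsP[s /existsP[t /and4P[s0 t0 /eqP <- nohole]]] _ du dv.
pose L := [set x | s + t <= degree e x].
have SomeI : injective (@Some V) by move=> a b [].
have [||||||||||c [cc uc Lc]] :=
    @cycle_through_large _ None (Some u) (Some v) (Some @: L) s t s0 t0 _ _ _ _
      (apex_rel e u v).
- by rewrite imset_f // inE.
- by rewrite imset_f // inE.
- by [].
- by apply/imsetP => -[].
- by move=> [a|] [b|] //=; rewrite e_sym.
- by move=> [a|] //=.
- move=> S T NS NT ST sS tT.
  (* Sets avoiding [None] correspond to sets of the same size in [V], where the absence of a hole
     applies. *)
  have pre (A : {set option V}) : None \notin A -> #|Some @^-1: A| = #|A|.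
    move=> NA; rewrite -(card_imset (Some @^-1: A) SomeI); congr #|pred_of_set _|.
    apply/setP => -[a|]; first by rewrite mem_imset // inE.
    by rewrite (negPf NA); apply/imsetP => -[].
  have [|||a [b [aS bT ab]]] :=
      @large_sets_have_edge _ _ _ _ (Some @^-1: S) (Some @^-1: T) nohole.
  + by rewrite -setI_eq0 -preimsetI (eqP (_ : S :&: T == set0)) ?preimset0 ?setI_eq0.
  + by rewrite pre.
  + by rewrite pre.
  by exists (Some a), (Some b); rewrite !inE in aS bT.
- move=> _ /imsetP[x + ->]; rewrite inE => /leq_trans; apply.
  rewrite /degree -(card_imset _ SomeI); apply: subset_leq_card.
  by apply/subsetP => _ /imsetP[y + ->]; rewrite !inE.
- by rewrite /= eqxx.
- by rewrite /= eqxx orbT.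
have mL x : s + t <= degree e x -> Some x \in c.
  by move=> dx; apply: Lc; rewrite setU1r // imset_f // inE.
have [p [pP pc]] := @apex_cycle_path _ e u v c e_sym uv cc uc
  (Lc _ (setU11 _ _)) (mL _ du) (mL _ dv).
by exists p; split=> // x /mL /pc.
Qed.
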